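(* Let $M$ be the adjacency matrix of a connected $r$-regular graph on $n$ vertices, and let $P$ (with parameter matrix $S$) and $R$ (with parameter matrix $T$) be perfect colorings of this graph such that the only common eigenvalue of $S$ and $T$ is $r$. Then for every column $P_i$ of $P$ and every column $R_j$ of $R$, $$\langle P_i,R_j\rangle=\frac{l_i m_j}{n},$$ where $l_i$ is the number of vertices of color $i$ in the coloring $P$ and $m_j$ is the number of vertices of color $j$ in the coloring $R$.
   Context: A graph is $r$-regular if its adjacency matrix is symmetric with all row and column sums equal to $r$. A perfect coloring of a graph with $n$ vertices and adjacency matrix $M$ in $k$ colors is given by an $n\times k$ $(0,1)$-matrix $P$ with exactly one entry $1$ in each row and no zero column, such that $MP=PS$ for some $k\times k$ matrix $S$, the parameter matrix. $\langle\cdot,\cdot\rangle$ is the standard dot product. *)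

(* Defs.v *)
From HB Require Import structures.
From mathcomp Require Import all_boot all_order all_algebra.

Set Implicit Arguments.
Unset Strict Implicit.
Unset Printing Implicit Defensive.

Import Order.TTheory GRing.Theory Num.Theory.
Local Open Scope ring_scope.

(* A graph on n vertices is given by its adjacency matrix A : 'M[nat]_n, where
   A x y is the number of edges from x to y. Simple graphs are the matrices
   with entries in {0, 1} and zero diagonal. *)

Definition regular_graph (n : nat) (A : 'M[nat]_n) (r : nat) : Prop :=
  [/\ A^T = A,
      forall x, (\sum_y A x y)%N = r
    & forall y, (\sum_x A x y)%N = r].

Definition connected_graph (n : nat) (A : 'M[nat]_n) : Prop :=
  forall x y : 'I_n, connect [rel u v | (0 < A u v)%N] x y.

Definition adjacency_mx (C : numClosedFieldType) (n : nat) (A : 'M[nat]_n) : 'M[C]_n :=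
  map_mx (fun m : nat => m%:R) A.

Definition coloring_mx (C : numClosedFieldType) (n k : nat)
    (P : 'M[C]_(n, k)) : Prop :=
  [/\ forall x i, P x i = 0 \/ P x i = 1,
      forall x, exists! i, P x i = 1
    & forall i, col i P <> 0].

Definition perfect_coloring (C : numClosedFieldType) (n k : nat)
    (M : 'M[C]_n) (P : 'M[C]_(n, k)) (S : 'M[C]_k) : Prop :=
  coloring_mx P /\ M *m P = P *m S.

(* Bilinear, without conjugation: it is only applied to (0,1)-vectors. *)
Definition dot_product (C : numClosedFieldType) (n : nat) (u v : 'cV[C]_n) : C :=
  \sum_x u x ord0 * v x ord0.

Definition color_class (C : numClosedFieldType) (n k : nat)
    (P : 'M[C]_(n, k)) (i : 'I_k) : {set 'I_n} :=
  [set x | P x i == 1].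

(* Main.v *)
(* Let Q = I - J/n, which commutes with M, and Y = P^T Q R. The claim is Y = 0.
   Since S^T Y = Y T, a nonzero Y would have in its row space an eigenvector w
   of T whose eigenvalue is also one of S, hence equal to r. By connectedness
   w is a multiple of 1^T R, so that w 1 is the same multiple of n. But Y 1 = 0,
   whence w 1 = 0 and w = 0. *)

Require Import Defs.
From HB Require Import structures.
From mathcomp Require Import all_boot all_order all_algebra.

Set Implicit Arguments.
Unset Strict Implicit.
Unset Printing Implicit Defensive.

Import Order.TTheory GRing.Theory Num.Theory.
Local Open Scope ring_scope.

Lemma eigenvalue_unitmx (F : fieldType) (n : nat) (A : 'M[F]_n) (a : F) :
  eigenvalue A a = (A - a%:M \notin unitmx).
Proof. by rewrite /eigenvalue /eigenspace kermx_eq0 row_free_unit. Qed.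

Lemma eigenvalue_trmx (F : fieldType) (n : nat) (A : 'M[F]_n) (a : F) :
  eigenvalue A^T a = eigenvalue A a.
Proof. by rewrite !eigenvalue_unitmx -unitmx_tr linearB /= trmxK tr_scalar_mx. Qed.

(** With [V] a basis of the row space of [Y], the square matrix [V *m B *m pinvmx V] expresses the
    action of [B] on that space in the basis [V]. It has positive size, hence an eigenvector [u]
    over the closed field, and [u *m V] is the vector sought. *)
Lemma stable_eigenvector (C : numClosedFieldType) (m n : nat)
    (Y : 'M[C]_(m, n)) (B : 'M[C]_n) :
  (Y *m B <= Y)%MS -> Y != 0 ->
  exists a (w : 'rV_n), [/\ w != 0, (w <= Y)%MS & w *m B = a *: w].
Proof.
move=> sYB Y0; pose V := row_base Y.
have VB : V *m B *m pinvmx V *m V = V *m B.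
  apply: mulmxKpV; rewrite (eqmxMr B (eq_row_base Y)).
  by rewrite (submx_trans sYB) // eq_row_base.
have [|a /eigenvalueP[u uV u0]] := @eigenvalue_closed C _ (V *m B *m pinvmx V).
  by rewrite lt0n mxrank_eq0.
exists a, (u *m V); split.
- by rewrite mulmx_free_eq0 // row_base_free.
- by rewrite (submx_trans (submxMl _ _)) // eq_row_base.
- by rewrite -mulmxA -VB mulmxA uV scalemxAl.
Qed.

(* If [A - a] were invertible, then [Y (B - a) = (A - a) Y] would have the rank
   of [Y], although [B - a] kills a nonzero vector of the row space of [Y]. *)
Lemma intertwining_eigenvector (C : numClosedFieldType) (m n : nat)
    (A : 'M[C]_m) (Y : 'M[C]_(m, n)) (B : 'M[C]_n) :
  A *m Y = Y *m B -> Y != 0 ->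
  exists a (w : 'rV_n),
    [/\ w != 0, (w <= Y)%MS, w *m B = a *: w & eigenvalue A a].
Proof.
move=> AY Y0; have sYB : (Y *m B <= Y)%MS by rewrite -AY submxMl.
have [a [w [w0 wY wB]]] := stable_eigenvector sYB Y0.
exists a, w; split=> //; rewrite eigenvalue_unitmx; apply/negP=> uA.
have AaY : (A - a%:M) *m Y = Y *m (B - a%:M).
  by rewrite mulmxBl mulmxBr AY mul_scalar_mx mul_mx_scalar.
have := mxrank_mul_ker Y (B - a%:M).
rewrite -AaY eqmxMfull ?row_full_unit // -[RHS]addn0 => /addnI /eqP.
rewrite mxrank_eq0 => /eqP cap0; case/negP: w0.
rewrite -submx0 -cap0 sub_capmx wY; apply/sub_kermxP.
by rewrite mulmxBr wB mul_mx_scalar subrr.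
Qed.

(* Since [M f = r f], the Dirichlet form
   [\sum_(x, y) A x y * `|f x - f y| ^+ 2] vanishes. *)
Lemma regular_eigenvector_const (C : numClosedFieldType) (n r : nat)
    (A : 'M[nat]_n) (f : 'cV[C]_n) :
  regular_graph A r -> connected_graph A ->
  adjacency_mx C A *m f = r%:R *: f -> exists c : C, f = c *: const_mx 1.
Proof.
move=> [Asym Arow Acol] Aconn fE.
have Mf x : \sum_y (A x y)%:R * f y 0 = r%:R * f x 0.
  have /matrixP/(_ x 0) := fE; rewrite !mxE => <-.
  by apply: eq_bigr => y _; rewrite !mxE.
have Asum x : \sum_y (A x y)%:R = r%:R :> C by rewrite -natr_sum Arow.
have Acsum y : \sum_x (A x y)%:R = r%:R :> C by rewrite -natr_sum Acol.
have Mfc x : \sum_y (A x y)%:R * (f y 0)^* = r%:R * (f x 0)^*.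
  rewrite -[r%:R]conjC_nat -rmorphM /= -Mf rmorph_sum.
  by apply: eq_bigr => y _; rewrite rmorphM /= conjC_nat.
have D0 : \sum_x \sum_y (A x y)%:R * `|f x 0 - f y 0| ^+ 2 = 0.
  (* Expanding the squared modulus as a product with the conjugate gives four double sums, all equal
     to [N]: the two square terms by the row and column sums of [A], the two cross terms by the
     eigenvector equation [Mf] and its conjugate [Mfc]. *)
  pose N := r%:R * \sum_x f x 0 * (f x 0)^*.
  have E1 : \sum_x \sum_y (A x y)%:R * (f x 0 * (f x 0)^*) = N.
    by rewrite /N mulr_sumr; apply: eq_bigr => x _; rewrite -mulr_suml Asum.
  have E2 : \sum_x \sum_y (A x y)%:R * (f y 0 * (f y 0)^*) = N.
    rewrite exchange_big /N mulr_sumr; apply: eq_bigr => y _.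
    by rewrite -mulr_suml Acsum.
  have E3 : \sum_x \sum_y (A x y)%:R * (f x 0 * (f y 0)^*) = N.
    rewrite /N mulr_sumr; apply: eq_bigr => x _.
    rewrite mulrCA -Mfc mulr_sumr; apply: eq_bigr => y _.
    by rewrite mulrCA.
  have E4 : \sum_x \sum_y (A x y)%:R * (f y 0 * (f x 0)^*) = N.
    rewrite /N mulr_sumr; apply: eq_bigr => x _.
    by rewrite mulrA -Mf mulr_suml; apply: eq_bigr => y _; rewrite mulrA.
  have -> : \sum_x \sum_y (A x y)%:R * `|f x 0 - f y 0| ^+ 2
      = (N - N) - (N - N).
    rewrite -{1}E1 -{1}E3 -{1}E4 -E2 -!sumrB; apply: eq_bigr => x _.
    rewrite -!sumrB; apply: eq_bigr => y _.
    by rewrite normCK rmorphB /= -!mulrBr mulrBl !mulrBr.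
  by rewrite subrr.
have edge x y : (0 < A x y)%N -> f x 0 = f y 0.
  have P0 u v : 0 <= (A u v)%:R * `|f u 0 - f v 0| ^+ 2.
    by rewrite mulr_ge0 ?ler0n ?exprn_ge0.
  have Dx := psumr_eq0P (fun u _ => sumr_ge0 _ (fun v _ => P0 u v)) D0
              (i := x) isT.
  have /eqP := psumr_eq0P (fun v _ => P0 x v) Dx (i := y) isT.
  rewrite mulf_eq0 pnatr_eq0 expf_eq0 /= normr_eq0 subr_eq0 lt0n.
  by case/orP=> [-> // | /eqP].
have fconst x y : f x 0 = f y 0.
  have /connectP[p] := Aconn x y.
  elim: p x => [|z p IHp] x /= => [_ -> // | /andP[/edge -> zp]].
  exact: IHp.
(* Without vertices there is no value of [f] to take as the constant, and [0] serves. *)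
case: n => [|n] in A f {Asym Arow Acol fE Mf Asum Acsum Mfc D0 edge Aconn}
  fconst *.
  by exists 0; apply/matrixP=> -[].
exists (f 0 0); apply/matrixP=> x j.
by rewrite !mxE mulr1 ord1; apply: fconst.
Qed.

Lemma coloring_row_sum (C : numClosedFieldType) (n k : nat)
    (P : 'M[C]_(n, k)) :
  coloring_mx P -> P *m (const_mx 1 : 'cV_k) = const_mx 1.
Proof.
move=> [P01 Puniq _].
apply/matrixP=> x j; rewrite !mxE.
have [i [Pi iuniq]] := Puniq x.
rewrite (bigD1 i) //= mxE Pi mulr1 big1 ?addr0 // => i' i'i.
have [->|/iuniq ii'] := P01 x i'; first by rewrite mul0r.
by rewrite ii' eqxx in i'i.
Qed.

Lemma coloring_col_sum (C : numClosedFieldType) (n k : nat)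
    (P : 'M[C]_(n, k)) (i : 'I_k) :
  coloring_mx P -> \sum_x P x i = (#|color_class P i|)%:R.
Proof.
move=> [P01 _ _].
rewrite -sum1_card natr_sum [RHS]big_mkcond; apply: eq_bigr => x _.
rewrite inE; have [->|->] := P01 x i; rewrite ?eqxx //.
by rewrite eq_sym oner_eq0.
Qed.

(** Color classes are disjoint, so the Gram matrix is diagonal with the class sizes on the diagonal;
    these are nonzero because no column of [P] vanishes. *)
Lemma coloring_gram_unitmx (C : numClosedFieldType) (n k : nat)
    (P : 'M[C]_(n, k)) :
  coloring_mx P -> P^T *m P \in unitmx.
Proof.
move=> Pcol; have [P01 Puniq Pcol0] := Pcol.
have -> : P^T *m P = diag_mx (\row_i (#|color_class P i|)%:R).
  apply/matrixP=> i j; rewrite !mxE.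
  have [<-|ij] := eqVneq i j.
    rewrite mulr1n -coloring_col_sum //; apply: eq_bigr => x _.
    by rewrite mxE; have [->|->] := P01 x i; rewrite ?mulr0 ?mulr1.
  rewrite mulr0n big1 // => x _; rewrite mxE.
  have [->|Pi] := P01 x i; first by rewrite mul0r.
  have [->|Pj] := P01 x j; first by rewrite mulr0.
  have [i0 [_ iuniq]] := Puniq x.
  by rewrite -(iuniq _ Pi) -(iuniq _ Pj) eqxx in ij.
rewrite unitmxE det_diag unitfE prodf_seq_neq0; apply/allP=> i _ /=.
rewrite mxE pnatr_eq0 cards_eq0; apply/eqP=> class0; apply: (Pcol0 i).
apply/matrixP=> x j; rewrite !mxE; have [//|Px] := P01 x i.
by have := in_set0 x; rewrite -class0 inE Px eqxx.
Qed.

Lemma tr_adjacency_mx (C : numClosedFieldType) (n r : nat) (A : 'M[nat]_n) :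
  regular_graph A r -> (adjacency_mx C A)^T = adjacency_mx C A.
Proof. by case=> Asym _ _; rewrite /adjacency_mx map_trmx Asym. Qed.

Lemma adjacency_mx_const (C : numClosedFieldType) (n r m : nat) (A : 'M[nat]_n) :
  regular_graph A r ->
  adjacency_mx C A *m (const_mx 1 : 'M_(n, m)) = const_mx r%:R.
Proof.
case=> _ Arow _; apply/matrixP=> x j; rewrite !mxE -(Arow x) natr_sum.
by apply: eq_bigr => y _; rewrite !mxE mulr1.
Qed.

(* [R^T R] is invertible and intertwines [T] with [T^T], so a left
   [r]-eigenvector [w] of [T] is [v^T R^T R] for a right one [v], and then
   [R v] is constant by connectedness. *)
Lemma perfect_coloring_left_eigenvector (C : numClosedFieldType)
    (n r k : nat) (A : 'M[nat]_n) (R : 'M[C]_(n, k)) (T : 'M[C]_k)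
    (w : 'rV[C]_k) :
  regular_graph A r -> connected_graph A ->
  perfect_coloring (adjacency_mx C A) R T ->
  w *m T = r%:R *: w -> exists c : C, w = c *: (const_mx 1 *m R).
Proof.
move=> Areg Aconn [Rcol MR] wT; set M := adjacency_mx C A in MR *.
have Msym : M^T = M := tr_adjacency_mx C Areg.
set D := R^T *m R; have Dunit : D \in unitmx := coloring_gram_unitmx Rcol.
have Dsym : D^T = D by rewrite trmx_mul trmxK.
(* Both sides equal [R^T *m M *m R], by [MR] and the symmetry of [M]. *)
have DT : D *m T = T^T *m D.
  by rewrite -mulmxA -MR !mulmxA -trmx_mul -MR trmx_mul Msym.
pose v := invmx D *m w^T.
have Dv : D *m v = w^T by rewrite mulKVmx.
have Tv : T *m v = r%:R *: v.
  apply: (can_inj (mulKmx Dunit)).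
  by rewrite mulmxA DT -mulmxA Dv -trmx_mul wT -scalemxAr Dv linearZ.
have [|c Rv] := regular_eigenvector_const (f := R *m v) Areg Aconn.
  by rewrite mulmxA -/M MR -mulmxA Tv -scalemxAr.
(* Transposed, the goal follows from [w^T = D *m v = R^T *m (R *m v)], where [R *m v] is [c] times
   the all-ones vector. *)
exists c; apply: trmx_inj; rewrite -Dv -mulmxA Rv -scalemxAr linearZ /=.
by rewrite trmx_mul trmx_const.
Qed.

Theorem theorem20 (C : numClosedFieldType) (n r k k' : nat) (A : 'M[nat]_n)
    (P : 'M[C]_(n, k)) (S : 'M[C]_k) (R : 'M[C]_(n, k')) (T : 'M[C]_k')
    (A_regular : regular_graph A r) (A_connected : connected_graph A)
    (P_perfect : perfect_coloring (adjacency_mx C A) P S)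
    (R_perfect : perfect_coloring (adjacency_mx C A) R T)
    (common_eigenvalue : forall a : C,
       eigenvalue S a /\ eigenvalue T a <-> a = r%:R) :
  forall (i : 'I_k) (j : 'I_k'),
    dot_product (col i P) (col j R) =
      (#|color_class P i|)%:R * (#|color_class R j|)%:R / n%:R.
Proof.
have [[Pcol MP] [Rcol MR]] := (P_perfect, R_perfect).
move=> i j; set M := adjacency_mx C A in MP MR.
(* A graph without vertices would make column [i] of [P] zero. *)
have n0 : n%:R != 0 :> C.
  rewrite pnatr_eq0; case: (n) (P) Pcol => // P0 [_ _ /(_ i) []].
  by apply/matrixP=> -[].
have Msym : M^T = M := tr_adjacency_mx C A_regular.
pose J : 'M[C]_n := const_mx 1; pose one m : 'cV[C]_m := const_mx 1.
have MJ : M *m J = const_mx r%:R := adjacency_mx_const C n A_regular.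
have JM : J *m M = const_mx r%:R.
  by apply: trmx_inj; rewrite trmx_mul Msym !trmx_const.
pose Q := 1%:M - n%:R^-1 *: J.
have MQ : M *m Q = Q *m M.
  by rewrite mulmxBr mulmxBl mulmx1 mul1mx -scalemxAl -scalemxAr MJ JM.
have Q1 : Q *m one n = 0.
  apply/matrixP=> x y; rewrite mulmxBl mul1mx -scalemxAl !mxE.
  under eq_bigr => z _ do rewrite !mxE mulr1.
  by rewrite sumr_const card_ord mulVf // subrr.
pose Y := P^T *m Q *m R.
(* Transposing [MP] turns [S^T *m P^T] into [P^T *m M]; then [M] moves past [Q] and is absorbed by
   [R] as [T]. *)
have SY : S^T *m Y = Y *m T.
  by rewrite /Y !mulmxA -trmx_mul -MP trmx_mul Msym -!mulmxA -MR !mulmxA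
             -[_ *m M *m Q]mulmxA MQ !mulmxA.
have Y1 : Y *m one k' = 0.
  by rewrite /Y -mulmxA coloring_row_sum // -mulmxA Q1 mulmx0.
have Y0 : Y = 0.
  apply/eqP; apply/negPn/negP=> Yn0.
  have [a [w [w0 wY wT]]] := intertwining_eigenvector SY Yn0.
  rewrite eigenvalue_trmx => Sa.
  have ar : a = r%:R.
    by apply/common_eigenvalue; split=> //; apply/eigenvalueP; exists w.
  rewrite {}ar in wT.
  have [c wE] := perfect_coloring_left_eigenvector A_regular A_connected
                   R_perfect wT.
  have w1 : w *m one k' = 0.
    by have /submxP[u ->] := wY; rewrite -mulmxA Y1 mulmx0.
  have /matrixP/(_ 0 0) := w1.
  rewrite wE -scalemxAl -mulmxA coloring_row_sum // !mxE.
  under eq_bigr => z _ do rewrite !mxE mulr1.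
  rewrite sumr_const card_ord => /eqP; rewrite mulf_eq0 (negPf n0) orbF.
  by move=> /eqP c0; rewrite wE c0 scale0r eqxx in w0.
(* Entry [(i, j)] of [Y = 0] equates the dot product with that entry of [P^T *m J *m R] divided by
   [n]; as [J] is all ones, the latter entry is a product of two column sums, the class sizes. *)
have /matrixP/(_ i j)/eqP := Y0.
rewrite /Y mulmxBr mulmx1 mulmxBl -scalemxAr -scalemxAl !mxE subr_eq0 => /eqP.
have -> : dot_product (col i P) (col j R) = \sum_x P^T i x * R x j.
  by apply: eq_bigr => x _; rewrite !mxE.
move=> ->; rewrite mulrC; congr (_ / _).
rewrite -coloring_col_sum // -coloring_col_sum // mulr_sumr.
apply: eq_bigr => y _; congr (_ * _); rewrite !mxE.
by apply: eq_bigr => x _; rewrite !mxE mulr1.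
Qed.
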